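(* Suppose $f\in C([0,1]^d)$ belongs to $KL$. Let $g$ be the associated (Lipschitz continuous) K-outer function with Lipschitz constant $C_g$, and let $C_\phi$ be the common Lipschitz constant of the K-inner functions $\phi_q$, $q=0,1,\dots,2d$ (i.e. $\phi_q\in \mathrm{Lip}_{C_\phi}(\alpha)$ for all $q$). Then, for all positive integers $p,n$, $$\inf_{s\in \mathcal{K}_{p,n}^{\sigma}}\|f-s\|_{C([0,1]^d)}\le C_g\,d(2d+1)\left(\frac{1}{n}+\frac{2KC_\phi}{p^{\alpha}}\right),\qquad \alpha=\log_{10}2.$$
   Context: Hölder classes: for $M\ge 0$, $0<\alpha\le 1$, a function $h:[a,b]\to\mathbb{R}$ belongs to $\mathrm{Lip}_M(\alpha)$ if $|h(x)-h(y)|\le M|x-y|^\alpha$ for all $x,y\in[a,b]$; $\mathrm{Lip}(\alpha)=\bigcup_{M}\mathrm{Lip}_M(\alpha)$. $\|\cdot\|_{C([0,1]^d)}$ is the sup norm. Kolmogorov superposition setting (Lorentz version; known theorem): fix irrational numbers $0<\lambda_i\le 1$ ($i=1,\dots,d$) and strictly increasing functions $\phi_q:[0,1]\to[0,1]$ ($q=0,\dots,2d$) in $\mathrm{Lip}(\alpha)$ with $\alpha=\log_{10}2$, independent of $f$, such that for every $f\in C([0,1]^d)$ there is a continuous $g:[0,d]\to\mathbb{R}$ with $$f(x_1,\dots,x_d)=\sum_{q=0}^{2d} g\Big(\sum_{i=1}^d\lambda_i\phi_q(x_i)\Big)\quad\text{for all }(x_1,\dots,x_d)\in[0,1]^d.$$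 The $\phi_q$ are called the K-inner functions and $g$ the K-outer function associated with $f$. $$KL=\{f\in C([0,1]^d): \text{the K-outer function } g \text{ of } f \text{ is Lipschitz continuous}\}.$$ Constant $K$: the positive constant of Jackson's theorem on $[0,1]$, i.e. an absolute constant such that for all $M\ge0$, $0<\beta\le1$, $h\in\mathrm{Lip}_M(\beta)$ on $[0,1]$ and $p\ge1$ there is a real polynomial $r$ of degree at most $p$ with $\max_{x\in[0,1]}|h(x)-r(x)|\le KM/p^{\beta}$. Network class: $\sigma(t)=\max\{t,0\}$ (ReLU). Let $x_1,\dots,x_{p+1}$ be the Gauss-Lobatto-Legendre points in $[0,1]$ and $\psi_j(x)=\prod_{i=1,i\ne j}^{p+1}\frac{x-x_i}{x_j-x_i}$, $j=1,\dots,p+1$, the Lagrange basis polynomials. $\mathcal{K}_{p,n}^{\sigma}$ is the set of all functions on $[0,1]^d$ of the form $$(x_1,\dots,x_d)\mapsto\sum_{q=0}^{2d}S\Big(\sum_{i=1}^d\lambda_i\widetilde L_q(x_i)\Big),\quad S(z)=\sum_{k=1}^n w_k\,\sigma(z-z_k),\quad \widetilde L_q(x)=1-\sigma\Big(1-\sigma\Big(\sum_{j=1}^{p+1}a_{j,q}\psi_j(x)\Big)\Big),$$ with free parameters $w_k\in\mathbb{R}$, $z_k\in[0,d]$, $a_{j,q}\in\mathbb{R}$, $\lambda_i\in(0,1]$ (here the $\lambda_i$ are free network parameters). Equivalently, $\widetilde L_q=\min\{\max\{L_q,0\},1\}$ with $L_q=\sum_j a_{j,q}\psi_j$. *)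

(* Defs.v *)
From HB Require Import structures.
From mathcomp Require Import all_boot all_order all_algebra.
From mathcomp Require Import all_classical all_reals all_analysis.
Set Implicit Arguments.
Unset Strict Implicit.
Unset Printing Implicit Defensive.
Import Order.TTheory GRing.Theory Num.Theory.
Import numFieldNormedType.Exports.
Local Open Scope classical_set_scope.
Local Open Scope ring_scope.

(* Functions on [a, b], [0, d] or [0, 1]^d are represented by functions on the
   whole of R or 'rV[R]_d; only their values on the intended domain matter. *)

Definition Lip (R : realType) (a b M alpha : R) (h : R -> R) : Prop :=
  0 <= M /\ forall x y : R, a <= x <= b -> a <= y <= b ->
    `|h x - h y| <= M * `|x - y| `^ alpha.

Definition log10_2 (R : realType) : R := ln 2 / ln 10.

Definition cube (R : realType) (d : nat) : set 'rV[R]_d :=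
  [set x | forall i, 0 <= x ord0 i <= 1].
Arguments cube R d : clear implicits.

Definition C_cube (R : realType) (d : nat) : set ('rV[R]_d -> R) :=
  [set f | {within cube R d, continuous f}].

Definition sup_norm (R : realType) (T : Type) (A : set T) (f : T -> R) : \bar R :=
  ereal_sup [set (`|f x|)%:E | x in A].

Definition K_sum (R : realType) (d : nat) (lambda : 'I_d -> R)
    (phi : 'I_(2 * d).+1 -> R -> R) (g : R -> R) (x : 'rV[R]_d) : R :=
  \sum_(q < (2 * d).+1) g (\sum_(i < d) lambda i * phi q (x ord0 i)).

Definition K_outer (R : realType) (d : nat) (lambda : 'I_d -> R)
    (phi : 'I_(2 * d).+1 -> R -> R) (f : 'rV[R]_d -> R) (g : R -> R) : Prop :=
  {within `[0, d%:R]%classic, continuous g} /\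
  forall x, cube R d x -> f x = K_sum lambda phi g x.

Record K_system (R : realType) (d : nat) (lambda : 'I_d -> R)
    (phi : 'I_(2 * d).+1 -> R -> R) : Prop := {
  K_lambda_irrational : forall i, irrational (lambda i);
  K_lambda_bounds : forall i, 0 < lambda i <= 1;
  K_inner_range : forall q t, 0 <= t <= 1 -> 0 <= phi q t <= 1;
  K_inner_increasing : forall q s t,
    0 <= s <= 1 -> 0 <= t <= 1 -> s < t -> phi q s < phi q t;
  K_inner_Lip : forall q, exists M, Lip 0 1 M (log10_2 R) (phi q);
  K_representation : forall f, C_cube f -> exists g, K_outer lambda phi f g }.

(* K-outer functions need not be unique: f belongs to KL when one of them is
   Lipschitz continuous. *)
Definition KL (R : realType) (d : nat) (lambda : 'I_d -> R)
    (phi : 'I_(2 * d).+1 -> R -> R) : set ('rV[R]_d -> R) :=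
  [set f | C_cube f /\ exists g, K_outer lambda phi f g /\
     [lipschitz g x | x in `[0, d%:R]%classic]].

(* A polynomial r has degree at most p when size r <= p.+1. *)
Definition Jackson_constant (R : realType) (K : R) : Prop :=
  0 < K /\
  forall (M beta : R) (h : R -> R) (p : nat),
    0 <= M -> 0 < beta <= 1 -> Lip 0 1 M beta h -> (0 < p)%N ->
    exists2 r : {poly R}, (size r <= p.+1)%N &
      forall x, 0 <= x <= 1 -> `|h x - r.[x]| <= K * M / p%:R `^ beta.

(* Rodrigues' formula, on [-1, 1]. *)
Definition legendre (R : realType) (p : nat) : {poly R} :=
  ((2 ^ p * p`!)%N%:R)^-1 *: (('X^2 - 1) ^+ p)^`(p).

(* On [-1, 1] the p + 1 Gauss-Lobatto-Legendre points are the zeros of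
   (1 - X^2) P_p'; they are transported to [0, 1] by u |-> (1 + u) / 2, and
   listed in increasing order. *)
Definition GLL_points (R : realType) (p : nat) (x : 'I_p.+1 -> R) : Prop :=
  (forall i j : 'I_p.+1, (i < j)%N -> x i < x j) /\
  (forall t : R, root ((1 - 'X^2) * (legendre R p)^`()) (2 * t - 1) <->
                 exists i, x i = t).

Definition lagrange_basis (R : realType) (p : nat) (x : 'I_p.+1 -> R)
    (j : 'I_p.+1) (t : R) : R :=
  \prod_(i < p.+1 | i != j) ((t - x i) / (x j - x i)).

Definition ReLU (R : realType) (t : R) : R := Num.max t 0.

Definition inner_net (R : realType) (p : nat) (x : 'I_p.+1 -> R)
    (a : 'I_p.+1 -> R) (t : R) : R :=
  1 - ReLU (1 - ReLU (\sum_(j < p.+1) a j * lagrange_basis x j t)).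

Definition outer_net (R : realType) (n : nat) (w z : 'I_n -> R) (t : R) : R :=
  \sum_(k < n) w k * ReLU (t - z k).

Definition K_net (R : realType) (d p n : nat) (x : 'I_p.+1 -> R) :
    set ('rV[R]_d -> R) :=
  [set s | exists (w z : 'I_n -> R) (a : 'I_(2 * d).+1 -> 'I_p.+1 -> R)
             (lambda : 'I_d -> R),
     [/\ forall k, 0 <= z k <= d%:R,
         forall i, 0 < lambda i <= 1 &
         s = K_sum lambda (fun q => inner_net x (a q)) (outer_net w z)]].

(* Main.v *)
Require Import Defs.
From HB Require Import structures.
From mathcomp Require Import all_boot all_order all_algebra.
From mathcomp Require Import all_classical all_reals all_analysis.
From mathcomp Require Import ring lra.
Set Implicit Arguments.
Unset Strict Implicit.
Unset Printing Implicit Defensive.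
Import Order.TTheory GRing.Theory Num.Theory.
Import numFieldNormedType.Exports.
Local Open Scope classical_set_scope.
Local Open Scope ring_scope.

(** The bound holds because each ingredient of the superposition
    [f = sum_q g (sum_i lambda_i phi_q (x_i))] can be replaced by its network
    counterpart at a controlled cost, keeping the weights [lambda].

    Inner functions.  Jackson's theorem gives polynomials [Q_q] of degree at
    most [p] within [eps = K Cphi / p ^ alpha] of [phi_q].  The polynomial
    [b (Q_q + c)] with [c >= eps] and [b] small maps [0, 1] into itself, so the
    two clippings in the inner network do nothing to it, and Lagrange
    interpolation at the nodes writes it in the required form
    ([inner_net_poly]).  The outer network then receives [b (t' + c L)], where
    [L = sum_i lambda_i <= d] and [t'] is within [L eps] of the exact argument
    [t] of [g]: an affine change of variable that [S] can undo.

    Outer function.  Let [h = d / n] and let [T] interpolate [g] linearly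
    between the nodes [h, 2 h, ..., n h = d], extended by the constant [g h] on
    the left.  It is a constant plus [n - 1] ReLU ramps, it is [Cg]-Lipschitz on
    the whole line ([relu_interp_lipschitz]), and it is within [Cg h] of [g] on
    [0, d] ([relu_interp_approx]).  One ramp remains for the constant [g h],
    which a single ramp equals on no interval unless it is 0.  With its knot at 0
    the ramp imitates it: in terms of [t'] it is the line
    [g h * (1 + t' / (c L))], which tends to [g h] uniformly as [c] grows
    ([outer_net_relu_interp]).

    Hence each of the [2 d + 1] terms costs at most
    [|g t - T t| + |T t - T t'| <= Cg d / n + Cg d eps], up to an arbitrarily
    small amount, which the infimum absorbs ([K_net_approx]).  The Lipschitz
    bound for [T] on the whole line is what allows [t'] to leave [0, d], and it
    gives [eps] where the announced bound has [2 eps]. *)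

(** * Inner networks *)

Lemma ReLU_id (R : realType) (t : R) : 0 <= t -> ReLU t = t.
Proof. exact: max_l. Qed.

Lemma ReLU_eq0 (R : realType) (t : R) : t <= 0 -> ReLU t = 0.
Proof. exact: max_r. Qed.

Lemma ReLU_pM (R : realType) (b t : R) : 0 <= b -> ReLU (b * t) = b * ReLU t.
Proof. by move=> b0; rewrite /ReLU maxr_pMr// mulr0. Qed.

Lemma lagrange_basis_node (R : realType) (p : nat) (x : 'I_p.+1 -> R) :
  injective x -> forall j k, lagrange_basis x j (x k) = (j == k)%:R.
Proof.
move=> x_inj j k; rewrite /lagrange_basis; have [<-|jk] := eqVneq j k.
  by apply: big1 => i ij; rewrite divff// subr_eq0 (inj_eq x_inj) eq_sym.
by rewrite (bigD1 k) 1?eq_sym//= subrr !mul0r.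
Qed.

(** Both sides are polynomials of size at most [p + 1] in [t], and they agree
    at the [p + 1] distinct nodes. *)
Lemma lagrange_interpolation (R : realType) (p : nat) (x : 'I_p.+1 -> R)
    (P : {poly R}) (t : R) : injective x -> (size P <= p.+1)%N ->
  \sum_(j < p.+1) P.[x j] * lagrange_basis x j t = P.[t].
Proof.
move=> x_inj sizeP.
pose ell j : {poly R} :=
  \prod_(i < p.+1 | i != j) ((x j - x i)^-1 *: ('X - (x i)%:P)).
have ellE j s : (ell j).[s] = lagrange_basis x j s.
  rewrite /ell /lagrange_basis horner_prod; apply: eq_bigr => i _.
  by rewrite hornerZ hornerXsubC mulrC.
have size_ell j : (size (ell j) <= p.+1)%N.
  have /leq_sum sum2 i : i != j ->
      (size ((x j - x i)^-1 *: ('X - (x i)%:P)) <= 2)%N.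
    by rewrite (leq_trans (size_scale_leq _ _)) ?size_XsubC.
  rewrite (leq_trans (size_poly_prod_leq _ _))// leq_subLR cardC1 card_ord/=.
  rewrite addnS ltnS (leq_trans (sum2 _))// sum_nat_const cardC1 card_ord/=.
  by rewrite muln2 addnn.
pose D := P - \sum_(j < p.+1) P.[x j] *: ell j.
suff D0 : D = 0.
  rewrite -[in RHS](subr0 P) -[in RHS]D0 /D opprB addrC subrK.
  by rewrite horner_sum; apply: eq_bigr => j _; rewrite hornerZ ellE.
apply: (@roots_geq_poly_eq0 _ _ (codom x)).
- apply/allP => _ /codomP[k ->]; rewrite /root /D hornerD hornerN horner_sum.
  rewrite (bigD1 k)//= big1 => [|j jk]; rewrite hornerZ ellE.
    by rewrite lagrange_basis_node// eqxx mulr1 addr0 subrr.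
  by rewrite lagrange_basis_node// (negbTE jk) mulr0.
- by rewrite map_inj_uniq ?enum_uniq.
- rewrite size_codom card_ord (leq_trans (size_polyD _ _))// geq_max sizeP.
  rewrite size_polyN (leq_trans (size_sum _ _ _))//; apply/bigmax_leqP => j _.
  exact: leq_trans (size_scale_leq _ _) (size_ell j).
Qed.

(** The two ReLUs of the inner network clip to [0, 1], so they leave unchanged
    a polynomial whose value already lies there. *)
Lemma inner_net_poly (R : realType) (p : nat) (x : 'I_p.+1 -> R)
    (P : {poly R}) (t : R) : injective x -> (size P <= p.+1)%N ->
  0 <= P.[t] <= 1 -> inner_net x (fun j => P.[x j]) t = P.[t].
Proof.
move=> x_inj sizeP /andP[P0 P1]; rewrite /inner_net lagrange_interpolation//.
by rewrite (ReLU_id P0) ReLU_id ?subr_ge0// subKr.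
Qed.

(** * Linear interpolation by ReLU ramps *)

(** The piecewise linear interpolant of the values [v k] at the nodes
    [a + k h], constant to the left of [a]: the coefficient of each ramp is the
    change of slope at its node.  At the first node [k.-1] is [k] itself, so the
    incoming slope is 0. *)
Definition relu_interp (R : realType) (v : nat -> R) (a h : R) (m : nat)
    (z : R) : R :=
  v 0%N + \sum_(k < m) (v k.+1 - v k - (v k - v k.-1)) / h *
                       ReLU (z - (a + k%:R * h)).

Section ReluInterp.
Variables (R : realType) (v : nat -> R) (a h : R).
Hypothesis h_gt0 : 0 < h.

Lemma relu_interpS m z : relu_interp v a h m.+1 z = relu_interp v a h m z +
  (v m.+1 - v m - (v m - v m.-1)) / h * ReLU (z - (a + m%:R * h)).
Proof. by rewrite /relu_interp big_ord_recr addrA. Qed.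

(** To the right of the last node the interpolant continues with the slope of
    the last piece; the sum of the slope changes telescopes to that slope. *)
Lemma relu_interp_right m z : a + m%:R * h <= z ->
  relu_interp v a h m z = v m + (v m - v m.-1) / h * (z - (a + m%:R * h)).
Proof.
elim: m => [|m IH] mz; first by rewrite /relu_interp big_ord0 subrr !mul0r.
have mz' : a + m%:R * h <= z.
  by apply: le_trans mz; rewrite lerD2l ler_pM2r// ler_nat.
rewrite relu_interpS IH// ReLU_id ?subr_ge0//= -natr1.
by field; rewrite gt_eqF.
Qed.

Lemma relu_interp_left m z : z <= a + m%:R * h ->
  relu_interp v a h m.+1 z = relu_interp v a h m z.
Proof. by move=> zm; rewrite relu_interpS ReLU_eq0 ?subr_le0// mulr0 addr0. Qed.

Lemma relu_interp_node m k : (k <= m)%N ->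
  relu_interp v a h m (a + k%:R * h) = v k.
Proof.
elim: m => [|m IH].
  by rewrite leqn0 => /eqP->; rewrite relu_interp_right// subrr !mul0r addr0.
rewrite leq_eqVlt => /predU1P[->|km].
  by rewrite relu_interp_right// subrr mulr0 addr0.
by rewrite relu_interp_left ?IH// lerD2l ler_pM2r// ler_nat.
Qed.

(** A new ramp changes nothing to the left of its node and replaces the
    interpolant by a line of slope at most [C] to the right; the two parts meet
    at the node, and a segment across it is cut there. *)
Lemma relu_interp_lipschitz C m : 0 <= C ->
    (forall k, (k < m)%N -> `|v k.+1 - v k| <= C * h) ->
  forall y z, `|relu_interp v a h m y - relu_interp v a h m z| <= C * `|y - z|.
Proof.
move=> C0; elim: m => [|m IH] vC y z.
  by rewrite /relu_interp !big_ord0 subrr normr0 mulr_ge0.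
have {}IH := IH (fun k km => vC k (ltnW km)).
wlog yz : y z / y <= z => [hw|].
  by case: (leP y z) => [|/ltW] yz; [|rewrite distrC (distrC y)]; apply: hw.
set T := relu_interp v a h m.+1; pose b := a + m%:R * h.
have Tl s t : s <= b -> t <= b -> `|T s - T t| <= C * `|s - t|.
  by move=> sb tb; rewrite /T !relu_interp_left// IH.
have TE t : b <= t -> T t = v m + (v m.+1 - v m) / h * (t - b).
  move=> bt; rewrite /T relu_interpS relu_interp_right// -/b.
  rewrite ReLU_id ?subr_ge0//.
  by ring.
have Tr s t : b <= s -> b <= t -> `|T s - T t| <= C * `|s - t|.
  move=> bs bt; rewrite (TE _ bs) (TE _ bt).
  rewrite (_ : _ - _ = (v m.+1 - v m) / h * (s - t)); last by ring.
  rewrite normrM ler_wpM2r// normrM normfV (gtr0_norm h_gt0).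
  by rewrite ler_pdivrMr// vC.
have [zb|/ltW bz] := leP z b; first by apply: Tl => //; exact: le_trans zb.
have [yb|/ltW by'] := leP y b; last exact: Tr.
rewrite (le_trans (ler_distD (T b) _ _))//.
rewrite (le_trans (lerD (Tl y b yb (lexx _)) (Tr b z (lexx _) bz)))//.
rewrite -mulrDr ler_wpM2l// ler0_norm ?subr_le0// ler0_norm ?subr_le0//.
by rewrite ler0_norm ?subr_le0//; lra.
Qed.
End ReluInterp.

(** [g] and the interpolant are both [C]-Lipschitz and agree at the nodes, so
    their distance at [z] is at most [2 C] times the distance from [z] to any
    node, and some node lies within [h / 2].  On the first interval [0, h] only
    the right end is a node, but there the interpolant is constant. *)
Lemma relu_interp_approx (R : realType) (g : R -> R) (C h : R) (m : nat) :
    0 <= C -> 0 < h ->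
    (forall y z, 0 <= y <= m.+1%:R * h -> 0 <= z <= m.+1%:R * h ->
      `|g y - g z| <= C * `|y - z|) ->
  forall z, 0 <= z <= m.+1%:R * h ->
  `|g z - relu_interp (fun k => g (k.+1%:R * h)) h h m z| <= C * h.
Proof.
move=> C0 h0; elim: m => [|m IH] gC z.
  rewrite mul1r => /andP[z0 zh]; rewrite /relu_interp big_ord0 addr0 mul1r.
  rewrite (le_trans (gC _ _ _ _)) ?mul1r ?z0 ?lexx ?(ltW h0)//.
  by rewrite ler_wpM2l// ler0_norm; lra.
move=> /andP[z0 zm]; set v := fun k : nat => _.
have stepE (k : nat) : k.+2%:R * h = k.+1%:R * h + h by rewrite -natr1; ring.
have nodeE (k : nat) : h + k%:R * h = k.+1%:R * h by rewrite -natr1; ring.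
have b0 : 0 <= m.+1%:R * h by rewrite mulr_ge0// ltW.
have [zb|/ltW bz] := leP z (m.+1%:R * h).
  rewrite relu_interp_left ?nodeE// IH ?z0// => s t /andP[s0 sm] /andP[t0 tm].
  by apply: gC; rewrite ?s0 ?t0 stepE/=; lra.
have vC k : (k < m.+1)%N -> `|v k.+1 - v k| <= C * h.
  move=> km; have le_km : k.+2%:R * h <= m.+2%:R * h.
    by rewrite ler_pM2r// ler_nat.
  rewrite (le_trans (gC _ _ _ _))//.
  - by rewrite le_km mulr_ge0// ltW.
  - rewrite mulr_ge0 ?(ltW h0)//=; apply: le_trans le_km.
    by rewrite ler_pM2r// ler_nat.
  - by rewrite stepE addrC addKr gtr0_norm.
have near_node k : (k <= m.+1)%N ->
    `|g z - relu_interp v h h m.+1 z| <= C * `|z - k.+1%:R * h| *+ 2.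
  move=> km; set t := k.+1%:R * h.
  have Tt : relu_interp v h h m.+1 t = g t.
    by rewrite /t -[in LHS]nodeE relu_interp_node.
  rewrite (le_trans (ler_distD (g t) _ _))// mulr2n lerD//.
    apply: gC; rewrite ?z0//= mulr_ge0 ?(ltW h0)//=.
    by rewrite ler_pM2r// ler_nat.
  by rewrite -[X in `|X - _|]Tt distrC relu_interp_lipschitz.
have [zmid|/ltW midz] := leP (z - m.+1%:R * h) (h / 2).
  apply: (le_trans (near_node m (leqnSn m))).
  rewrite ger0_norm ?subr_ge0// -mulrnAr ler_wpM2l//.
  by rewrite mulr2n; lra.
apply: (le_trans (near_node m.+1 (leqnn _))).
rewrite ler0_norm ?subr_le0// -mulrnAr ler_wpM2l//.
by rewrite mulr2n stepE; lra.
Qed.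

(** * Outer networks *)

(** The ramps of the interpolant are rescaled by the affine change of variable
    [y |-> b (y + mu)]; its constant term is replaced by the ramp with knot 0,
    which in the variable [y] is the line [v 0 * (1 + y / mu)].  Large [mu]
    makes this line almost constant on any bounded set, and small [b] keeps the
    knots in [0, D]. *)
Lemma outer_net_relu_interp (R : realType) (D b mu : R) (v : nat -> R)
    (a h : R) (m : nat) :
    0 <= D -> 0 < b -> 0 < mu -> 0 <= a -> 0 <= h ->
    (forall k, (k < m)%N -> b * (a + k%:R * h + mu) <= D) ->
  exists w z : 'I_m.+1 -> R, (forall k, 0 <= z k <= D) /\
    forall y, - mu <= y -> outer_net w z (b * (y + mu)) =
      relu_interp v a h m y + v 0%N * y / mu.
Proof.
move=> D0 b0 mu0 a0 h0 kD.
exists (fun k => if val k is k'.+1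
  then (v k'.+1 - v k' - (v k' - v k'.-1)) / h / b else v 0%N / (b * mu)).
exists (fun k => if val k is k'.+1 then b * (a + k'%:R * h + mu) else 0).
split=> [[[|k] km]/=|y muy]; first by rewrite lexx.
  by rewrite kD// andbT mulr_ge0 ?(ltW b0)// !addr_ge0 ?mulr_ge0// ltW.
rewrite /outer_net big_ord_recl/= subr0 ReLU_id; last first.
  by rewrite mulr_ge0 ?(ltW b0)//; lra.
rewrite /relu_interp addrAC; congr (_ + _).
  by field; rewrite !gt_eqF.
apply: eq_bigr => k _; rewrite /bump/=.
have -> : b * (y + mu) - b * (a + k%:R * h + mu) = b * (y - (a + k%:R * h)).
  by ring.
by rewrite ReLU_pM ?(ltW b0)// mulrA mulfVK// gt_eqF.
Qed.

(** * The network approximation *)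

Lemma log10_2_bounds (R : realType) : 0 < log10_2 R <= 1.
Proof.
have ln2 : 0 < ln (2 : R) by rewrite ln_gt0// ltr1n.
have le_ln : ln (2 : R) <= ln 10 by rewrite ler_ln ?posrE// ler_nat.
have ln10 := lt_le_trans ln2 le_ln.
by rewrite /log10_2 divr_gt0//= ler_pdivrMr// mul1r.
Qed.

(** The three parts of the error of one term are the interpolation of [g], the
    displacement of its argument caused by the polynomials [Q q], and [eta], the
    price of the line used in place of a constant. *)
Lemma K_net_approx (R : realType) (d p n : nat) (lambda : 'I_d -> R)
    (phi : 'I_(2 * d).+1 -> R -> R) (Q : 'I_(2 * d).+1 -> {poly R})
    (x : 'I_p.+1 -> R) (g : R -> R) (C eps eta : R) :
    (0 < d)%N -> (0 < n)%N -> 0 <= C -> 0 <= eps -> 0 < eta -> injective x ->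
    (forall i, 0 < lambda i <= 1) ->
    (forall q t, 0 <= t <= 1 -> 0 <= phi q t <= 1) ->
    (forall q, (size (Q q) <= p.+1)%N) ->
    (forall q t, 0 <= t <= 1 -> `|phi q t - (Q q).[t]| <= eps) ->
    (forall y z, 0 <= y <= d%:R -> 0 <= z <= d%:R ->
      `|g y - g z| <= C * `|y - z|) ->
  exists2 s, K_net n x s & forall y, cube R d y ->
    `|K_sum lambda phi g y - s y| <=
      (2 * d%:R + 1) * (C * (d%:R / n%:R) + C * (d%:R * eps) + eta).
Proof.
move=> d_gt0; case: n => // m _ C0 eps0 eta0 x_inj lambdaP phiP sizeQ QP gC.
have D0 : 0 < d%:R :> R by rewrite ltr0n.
have D1 : 1 <= d%:R :> R by rewrite ler1n.
pose h : R := d%:R / m.+1%:R; have h0 : 0 < h by rewrite divr_gt0.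
have mhE : m.+1%:R * h = d%:R by rewrite /h mulrC divfK.
pose L := \sum_(i < d) lambda i.
have L0 : 0 < L.
  rewrite /L (bigD1 (Ordinal d_gt0))//= ltr_pwDl//.
    by case/andP: (lambdaP (Ordinal d_gt0)).
  by apply: sumr_ge0 => i _; case/andP: (lambdaP i) => /ltW.
have wsum (u : 'I_d -> R) (B : R) : (forall i, `|u i| <= B) ->
    `|\sum_(i < d) lambda i * u i| <= L * B.
  move=> uB; rewrite (le_trans (ler_norm_sum _ _ _))// /L mulr_suml ler_sum//.
  move=> i _; have /andP[li0 _] := lambdaP i.
  by rewrite normrM gtr0_norm// ler_pM2l.
have LD : L <= d%:R.
  rewrite -[X in _ <= X%:R]card_ord -sum1_card natr_sum ler_sum// => i _.
  by case/andP: (lambdaP i).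
pose v k := g (k.+1%:R * h).
(* The shift [c] must exceed [eps], so that [Q q + c] is nonnegative, and be
   large enough for the line replacing the constant [v 0] to stay within [eta]
   of it when its argument is at most [d (1 + eps)] in absolute value. *)
pose c := eps + `|v 0%N| * (d%:R * (1 + eps)) / (eta * L) + 1.
have c_large : eps <= c /\ `|v 0%N| * (d%:R * (1 + eps)) <= eta * (c * L).
  have A0 : 0 <= `|v 0%N| * (d%:R * (1 + eps)) / (eta * L).
    by rewrite divr_ge0// !mulr_ge0 ?(ltW D0) ?(ltW eta0) ?(ltW L0) ?addr_ge0.
  split; first by rewrite /c; lra.
  by rewrite [leRHS]mulrCA -ler_pdivrMr ?mulr_gt0// /c; lra.
case: c_large => eps_c c_eta.
have c0 : 0 < c.
  rewrite /c ltr_wpDl// addr_ge0// divr_ge0// !mulr_ge0 ?(ltW D0) ?(ltW L0)//.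
  - by rewrite addr_ge0.
  - exact: ltW.
have cL0 : 0 < c * L by rewrite mulr_gt0.
(* The largest value of [Q q + c] on [0, 1] is at most [1 + eps + c]. *)
pose b := (1 + eps + c)^-1.
have b0 : 0 < b by rewrite invr_gt0; lra.
have bE : b * (1 + eps + c) = 1 by rewrite mulVf// gt_eqF//; lra.
have knot_le k : (k < m)%N -> b * (h + k%:R * h + c * L) <= d%:R.
  move=> km; have hk : h + k%:R * h <= d%:R.
    rewrite (_ : _ + _ = k.+1%:R * h); last by rewrite -natr1; ring.
    by rewrite -mhE ler_pM2r// ler_nat ltnW.
  have cLD : c * L <= c * d%:R by rewrite ler_pM2l.
  have epsD : 0 <= eps * d%:R by rewrite mulr_ge0// ltW.
  have -> : d%:R = b * ((1 + eps + c) * d%:R) by rewrite mulrA bE mul1r.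
  by rewrite ler_pM2l//; lra.
have [w [z [zP netE]]] :=
  outer_net_relu_interp v (ltW D0) b0 cL0 (ltW h0) (ltW h0) knot_le.
pose P q := b *: (Q q + c%:P).
have PE q t : (P q).[t] = b * ((Q q).[t] + c).
  by rewrite hornerZ hornerD hornerC.
have sizeP q : (size (P q) <= p.+1)%N.
  rewrite (leq_trans (size_scale_leq _ _))// (leq_trans (size_polyD _ _))//.
  by rewrite geq_max sizeQ (leq_trans (size_polyC_leq1 _)).
have P01 q t : 0 <= t <= 1 -> 0 <= (P q).[t] <= 1.
  move=> t01; have := QP q t t01; have /andP[p0 p1] := phiP q t t01.
  rewrite ler_norml PE => /andP[Q0 Q1]; rewrite mulr_ge0 ?(ltW b0)//=; last lra.
  by rewrite -[leRHS]bE ler_pM2l//; lra.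
eexists.
  by exists w, z, (fun q j => (P q).[x j]), lambda; split.
move=> y y01; rewrite /K_sum -sumrB (le_trans (ler_norm_sum _ _ _))//.
have -> : (2 * d%:R + 1) * (C * (d%:R / m.+1%:R) + C * (d%:R * eps) + eta) =
    \sum_(q < (2 * d).+1) (C * h + C * (d%:R * eps) + eta).
  by rewrite sumr_const card_ord -[RHS]mulr_natl -[in RHS]natr1 natrM.
apply: ler_sum => q _.
set t := \sum_(i < d) lambda i * phi q _.
pose t' := \sum_(i < d) lambda i * (Q q).[y ord0 i].
have -> : \sum_(i < d) lambda i * inner_net x (fun j => (P q).[x j]) (y ord0 i)
    = b * (t' + c * L).
  rewrite /t' /L !mulr_sumr -big_split mulr_sumr; apply: eq_bigr => i _/=.
  by rewrite inner_net_poly// ?P01// PE; ring.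
have tt' : `|t - t'| <= L * eps.
  rewrite /t /t' -sumrB; under eq_bigr do rewrite -mulrBr.
  by apply: wsum => i; apply: QP.
have t0D : 0 <= t <= L.
  rewrite sumr_ge0 => [|i _]; last first.
    have /andP[/ltW l0 _] := lambdaP i; have /andP[p0 _] := phiP q _ (y01 i).
    by rewrite mulr_ge0.
  rewrite (le_trans (ler_norm _))// -[X in _ <= X]mulr1 wsum// => i.
  by have /andP[p0 p1] := phiP q _ (y01 i); rewrite ger0_norm.
have Leps : L * eps <= d%:R * eps by rewrite ler_wpM2r.
have LepsC : L * eps <= c * L by rewrite mulrC ler_pM2r.
have abs_t' : `|t'| <= d%:R * (1 + eps).
  rewrite mulrDr mulr1 -[t'](subrK t) (le_trans (ler_normD _ _))// addrC distrC.
  have /andP[t0 tL] := t0D.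
  by rewrite lerD// ?(le_trans tt')// ger0_norm// (le_trans tL).
rewrite netE; last first.
  by move: tt' t0D; rewrite ler_norml => /andP[_ t1] /andP[t2 _]; lra.
have near_const : `|v 0%N * t' / (c * L)| <= eta.
  rewrite !normrM normfV (gtr0_norm cL0) ler_pdivrMr//.
  by rewrite (le_trans _ c_eta)// ler_wpM2l.
have interp : `|g t - relu_interp v h h m t| <= C * h.
  apply: relu_interp_approx => //; rewrite mhE//.
  by case/andP: t0D => -> /le_trans->.
have move_arg :
    `|relu_interp v h h m t - relu_interp v h h m t'| <= C * (d%:R * eps).
  apply: (@le_trans _ _ (C * `|t - t'|)).
    apply: relu_interp_lipschitz => // k km.
    rewrite (le_trans (gC _ _ _ _))//.
    - by rewrite -mhE mulr_ge0 ?(ltW h0)//= ler_pM2r// ler_nat.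
    - by rewrite -mhE mulr_ge0 ?(ltW h0)//= ler_pM2r// ler_nat ltnW.
    - by rewrite -mulrBl -natrB// subSnn mul1r gtr0_norm.
  by rewrite ler_wpM2l// (le_trans tt').
rewrite opprD addrA (le_trans (ler_normB _ _))// lerD//.
by rewrite (le_trans (ler_distD (relu_interp v h h m t) _ _))// lerD.
Qed.

Theorem theorem2 (R : realType) (d : nat) (d_gt0 : (0 < d)%N)
  (lambda : 'I_d -> R) (phi : 'I_(2 * d).+1 -> R -> R)
  (K_sys : K_system lambda phi)
  (K : R) (K_Jackson : Jackson_constant K)
  (f : 'rV[R]_d -> R) (f_KL : KL lambda phi f)
  (g : R -> R) (g_outer : K_outer lambda phi f g)
  (Cg : R) (g_lip : Cg.-lipschitz_(`[0, d%:R]%classic) g)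
  (Cphi : R) (phi_Lip : forall q, Lip 0 1 Cphi (log10_2 R) (phi q))
  (p n : nat) (p_gt0 : (0 < p)%N) (n_gt0 : (0 < n)%N)
  (x : 'I_p.+1 -> R) (x_GLL : GLL_points x) :
  (ereal_inf [set sup_norm (cube R d) (fun y => f y - s y)%R
             | s in @K_net R d p n x]
   <= (Cg * d%:R * (2 * d%:R + 1) *
        (n%:R^-1 + 2 * K * Cphi / p%:R `^ log10_2 R))%R%:E)%E.
Proof.
have [_ fE] := g_outer; have [K_gt0 jackson] := K_Jackson.
have D0 : 0 < d%:R :> R by rewrite ltr0n.
have gC y z : 0 <= y <= d%:R -> 0 <= z <= d%:R ->
    `|g y - g z| <= Cg * `|y - z|.
  by move=> yD zD; apply: (g_lip (y, z)); split; rewrite /= in_itv.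
have Cg0 : 0 <= Cg.
  have := gC d%:R 0; rewrite !lexx (ltW D0) subr0 (gtr0_norm D0).
  by move=> /(_ isT isT)/(le_trans (normr_ge0 _)); rewrite pmulr_lge0.
have Cphi0 : 0 <= Cphi by have [] := phi_Lip ord0.
pose eps := K * Cphi / p%:R `^ log10_2 R.
have eps0 : 0 <= eps by rewrite divr_ge0 ?powR_ge0 ?mulr_ge0// ltW.
have /choice[Q QP] (q : 'I_(2 * d).+1) : exists r : {poly R},
    (size r <= p.+1)%N /\
    forall t, 0 <= t <= 1 -> `|phi q t - r.[t]| <= eps.
  have [r sizer rP] :=
    jackson _ _ _ _ Cphi0 (log10_2_bounds R) (phi_Lip q) p_gt0.
  by exists r.
have x_inj : injective x.
  case: x_GLL => x_incr _ i j xij; apply: val_inj.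
  by case: (ltngtP i j) => // /x_incr; rewrite xij ltxx.
apply/lee_addgt0Pr => e e0.
have S0 : 0 < 2 * d%:R + 1 :> R by lra.
have [s sK sP] := K_net_approx d_gt0 n_gt0 Cg0 eps0 (divr_gt0 e0 S0) x_inj
  (K_lambda_bounds K_sys) (K_inner_range K_sys) (fun q => (QP q).1)
  (fun q => (QP q).2) gC.
apply: le_trans (ereal_inf_lbound _) _; first by exists s.
apply: ge_ereal_sup => _ [y yD <-]; rewrite -EFinD lee_fin (fE _ yD).
rewrite (le_trans (sP _ yD))//.
rewrite (_ : 2 * K * Cphi / _ = 2 * eps); last by rewrite /eps; ring.
rewrite mulrDr (mulrC (2 * _ + 1) (e / _)) divfK ?gt_eqF// lerD2r.
have -> : Cg * (d%:R / n%:R) + Cg * (d%:R * eps) = Cg * d%:R * (n%:R^-1 + eps).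
  by ring.
rewrite mulrA (mulrC (2 * _ + 1)) ler_wpM2l//; last lra.
by rewrite !mulr_ge0// ltW.
Qed.
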